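(* For any pair $(m,r)$ of an integer $m>1$ and $r\in\{0,1,2,\ldots,m\}$, there exist a positive integer $l$ and a Clifford system $\{P_i\}_{i=1}^m$ $(P_i\in\mathrm{Sym}(\mathbb{R}^{2l}_l))$ of signature $(m,r)$ on $\mathbb{R}^{2l}_l$.
   Context: For $0\le s\le n$, $\mathbb{R}^n_s$ denotes $\mathbb{R}^n$ with the pseudo-inner product $\langle u,v\rangle={}^t u\,J_{s,n-s}\,v$, where $J_{i,j}:=(-E_i)\oplus E_j$ is the diagonal matrix with $i$ entries $-1$ followed by $j$ entries $+1$ ($J_{0,j}=E_j$, $J_{i,0}=-E_i$). $\mathrm{Sym}(\mathbb{R}^n_s)$ is the set of linear endomorphisms $Q$ of $\mathbb{R}^n_s$ with $\langle Qu,v\rangle=\langle u,Qv\rangle$ for all $u,v$. For a positive integer $l$, $s\in\{0,\ldots,2l\}$, an integer $m>1$ and $r\in\{0,\ldots,m\}$, a Clifford system of signature $(m,r)$ on $\mathbb{R}^{2l}_s$ is a family $\{P_i\}_{i=1}^m$ with $P_i\in\mathrm{Sym}(\mathbb{R}^{2l}_s)$ and $P_iP_j+P_jP_i=2\eta_{ij}I$ for all $i,j\in\{1,\ldots,m\}$, where $(\eta_{ij})=J_{r,m-r}$ and $I$ is the identity. *)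

(* Defs.v *)
(* The real numbers are an arbitrary R : realType, in the Mathematical Components library. *)
From mathcomp Require Import all_boot all_order all_algebra.
From mathcomp Require Import reals.

Set Implicit Arguments.
Unset Strict Implicit.
Unset Printing Implicit Defensive.

Import GRing.Theory.
Local Open Scope ring_scope.

(* J_{s,n-s}: s entries -1 followed by n-s entries +1; only meant for s <= n. *)
Definition sigmx (R : realType) (n s : nat) : 'M[R]_n :=
  diag_mx (\row_(i < n) (if (i < s)%N then -1 else 1)).

Definition pinner (R : realType) (n s : nat) (u v : 'cV[R]_n) : R :=
  (u^T *m sigmx R n s *m v) 0 0.

(* Q \in Sym(R^n_s) *)
Definition psym (R : realType) (n s : nat) (Q : 'End('cV[R]_n)) : Prop :=
  forall u v : 'cV[R]_n, pinner s (Q u) v = pinner s u (Q v).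

(* Members are indexed by 0, ..., m-1 instead of 1, ..., m.  The range
   conditions 0 < l, s <= 2l, 1 < m and r <= m are part of the notion. *)
Definition clifford_system (R : realType) (l s m r : nat)
    (P : 'I_m -> 'End('cV[R]_(2 * l))) : Prop :=
  [/\ [&& 0 < l, s <= 2 * l, 1 < m & r <= m]%N,
      forall i, psym s (P i)
    & forall i j, (P i \o P j)%VF + (P j \o P i)%VF =
                  (2 * sigmx R m r i j) *: \1%VF].

Arguments clifford_system {R} l s m r P.

(* Main.v *)
Require Import Defs.
From mathcomp Require Import all_boot all_order all_algebra.
From mathcomp Require Import reals.
Local Open Scope ring_scope.

(** It suffices to find real square matrices [X_i], pairwise anticommuting, with
    [X_i^2 = eta_i] and [X_i^T = eta_i X_i] for the prescribed signs
    [eta_i]: a Clifford family that is symmetric or skew according to the sign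
    ([exists_signed_anticommuting]).  Such families exist for every choice of
    signs by a Jordan-Wigner doubling: replace each [X_i] by [diag(X_i, -X_i)]
    and adjoin the matrix with rows [(0, 1)] and [(eta, 0)].

    From such a family on [R^l], a Clifford system on
    [R^(2l)_l = R^l (x) R^2], whose form is [1 (x) diag(-1, 1)], arises by
    taking [X_i (x) 1] when [eta_i = 1] and [X_i (x) sigma] when [eta_i = -1],
    where [sigma] swaps the two copies of [R^l].  Since [1 (x) sigma] squares
    to 1 and commutes with every [X_j (x) 1], the Clifford relations persist; since
    [sigma] is skew-adjoint for [diag(-1, 1)], it turns the skew [X_i] into
    self-adjoint operators ([swap_double_self_adjoint]).  The signature of
    the ambient form is thus automatically neutral. *)

Import GRing.Theory.

Section Matrices.
Set Implicit Arguments.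
Unset Strict Implicit.
Variable R : realType.

(** Induction on [m], doubling the dimension: [diag(1, -1)] anticommutes with
    the new member, which keeps the old ones anticommuting with it.  Tying the
    transpose to the sign is what later yields self-adjointness. *)
Lemma exists_signed_anticommuting (neg : nat -> bool) (m : nat) :
  exists (n : nat) (X : nat -> 'M[R]_n),
    [/\ (0 < n)%N,
        forall i, (i < m)%N -> (X i)^T = (-1) ^+ neg i *: X i
      & forall i j, (i < m)%N -> (j < m)%N ->
          X i *m X j + X j *m X i = (2 * (-1) ^+ neg i *+ (i == j))%:M].
Proof.
elim: m => [|m [n [X [n_gt0 XT XX]]]].
  by exists 1%N, (fun=> 0); split.
pose Y : 'M[R]_(n + n) := block_mx 0 1%:M ((-1) ^+ neg m)%:M 0.
pose D i : 'M[R]_(n + n) := block_mx (X i) 0 0 (- X i).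
have DY i : D i *m Y + Y *m D i = 0.
  rewrite /D /Y !mulmx_block add_block_mx !mul0mx !mulmx0 !mulmx1 !mul1mx.
  rewrite !add0r !addr0 mul_mx_scalar mul_scalar_mx subrr scalerN addNr.
  exact: block_mx0.
exists (n + n)%N, (fun i => if (i < m)%N then D i else Y); split.
- by rewrite addn_gt0 n_gt0.
- move=> i; rewrite ltnS leq_eqVlt => /orP[/eqP->|im].
    rewrite ltnn /Y tr_block_mx !trmx0 !tr_scalar_mx scale_block_mx !scaler0.
    by rewrite !scale_scalar_mx mulr1 -signr_addb addbb.
  rewrite im /D tr_block_mx !trmx0 scale_block_mx !scaler0 linearN /=.
  by rewrite XT // scalerN.
- move=> i j; rewrite !ltnS [(i <= m)%N]leq_eqVlt [(j <= m)%N]leq_eqVlt.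
  move=> /orP[/eqP->|im] /orP[/eqP->|jm].
  + rewrite ltnn eqxx mulr1n /Y !mulmx_block !mul0mx !mulmx0 !mulmx1 !mul1mx.
    rewrite !add0r !addr0 add_block_mx !addr0.
    by rewrite mulr_natl mulr2n scalar_mx_block raddfD.
  + rewrite ltnn jm addrC DY gtn_eqF //.
    by rewrite mulr0n raddf0.
  + by rewrite ltnn im DY ltn_eqF // mulr0n raddf0.
  + rewrite im jm /D !mulmx_block !mul0mx !mulmx0 !add0r !addr0 add_block_mx.
    by rewrite !mulNmx !mulmxN !opprK !addr0 XX // scalar_mx_block.
Qed.

(** [X (x) sigma ^ b], where [sigma] exchanges the two copies of [R^n]. *)
Definition swap_double (n : nat) (b : bool) (X : 'M[R]_n) : 'M[R]_(n + n) :=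
  if b then block_mx 0 X X 0 else block_mx X 0 0 X.

Lemma swap_doubleM n b c (X Y : 'M[R]_n) :
  swap_double b X *m swap_double c Y = swap_double (b (+) c) (X *m Y).
Proof.
by case: b c => [] [] /=;
  rewrite mulmx_block !mul0mx !mulmx0 ?add0r ?addr0.
Qed.

Lemma swap_doubleD n b (X Y : 'M[R]_n) :
  swap_double b X + swap_double b Y = swap_double b (X + Y).
Proof. by case: b; rewrite add_block_mx !addr0. Qed.

Lemma sigmx_neutral n : sigmx R (n + n) n = block_mx (- 1%:M) 0 0 1%:M.
Proof.
apply/matrixP => i j; rewrite !mxE.
case: (splitP i) => i' ei; rewrite mxE; case: (splitP j) => j' ej;
  rewrite !mxE -val_eqE /= ei ej.
- by rewrite mulNrn.
- by rewrite ltn_eqF // ltn_addr.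
- by rewrite gtn_eqF // ltn_addr.
- by rewrite eqn_add2l.
Qed.

(** The sign of the transpose of [X] cancels the sign by which [sigma ^ b]
    commutes with the form [diag(-1, 1)]. *)
Lemma swap_double_self_adjoint n (b : bool) (X : 'M[R]_n) :
  X^T = (-1) ^+ b *: X ->
  (swap_double b X)^T *m sigmx R (n + n) n
    = sigmx R (n + n) n *m swap_double b X.
Proof.
rewrite sigmx_neutral; case: b => /= XT;
  rewrite tr_block_mx !trmx0 XT !mulmx_block !mul0mx !mulmx0 !add0r !addr0;
  by rewrite ?scaleN1r ?scale1r !mulNmx !mulmxN !mulmx1 !mul1mx ?opprK.
Qed.

(** The dimension is a variable [N], since the block decomposition lives in
    dimension [n + n], which is not convertible to [2 * n]. *)
Lemma exists_clifford_matrices (neg : nat -> bool) (m : nat) :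
  exists2 n : nat, (0 < n)%N &
    forall N, N = (n + n)%N ->
    exists M : nat -> 'M[R]_N,
      (forall i, (i < m)%N -> (M i)^T *m sigmx R N n = sigmx R N n *m M i) /\
      (forall i j, (i < m)%N -> (j < m)%N ->
          M i *m M j + M j *m M i = (2 * (-1) ^+ neg i *+ (i == j))%:M).
Proof.
have [n [X [n_gt0 XT XX]]] := exists_signed_anticommuting neg m.
exists n => // N ->; exists (fun i => swap_double (neg i) (X i)).
split=> [i im | i j im jm]; first exact/swap_double_self_adjoint/XT.
rewrite !swap_doubleM (addbC (neg j)) swap_doubleD XX //.
have [<-|_] := eqVneq i j; first by rewrite addbb /= -scalar_mx_block.
by rewrite mulr0n !raddf0; case: addb; apply: block_mx0.
Qed.

End Matrices.

Theorem theorem3p10 (R : realType) (m r : nat) (hm : (1 < m)%N) (hr : (r <= m)%N) :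
  exists (l : nat) (P : 'I_m -> 'End('cV[R]_(2 * l))),
    (0 < l)%N /\ clifford_system l l m r P.
Proof.
have [l l_gt0 ex_M] := exists_clifford_matrices R (fun i => i < r)%N m.
have [|M [M_adj MM]] := ex_M (2 * l)%N; first by rewrite mul2n addnn.
exists l, (fun i => linfun (mulmx (M i))); split=> //; split.
- by rewrite l_gt0 hm hr leq_pmull.
- move=> i u v; rewrite /pinner !lfunE /= trmx_mul -!mulmxA.
  by rewrite (mulmxA _^T (sigmx _ _ _)) M_adj // -mulmxA.
- move=> i j; apply/lfunP => v.
  rewrite !lfunE /= !lfunE /= !lfunE /= !mulmxA -mulmxDl MM // mul_scalar_mx.
  by rewrite !mxE val_eqE mulrnAr; case: (i < r)%N.
Qed.
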